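(* Let $X$ be a non-negative random variable and let $Y=\varPsi(X)$, where $\varPsi(\cdot)$ is an increasing real-valued, positive and convex (respectively, concave) function. Then, for $\eta>0$, $Y$ is IDQFGCPE (respectively, DDQFGCPE) if $X$ is IDQFGCPE (respectively, DDQFGCPE).
   Context: Random variables are non-negative and absolutely continuous; $\varPsi$ is differentiable. For a random variable $X$ with distribution function $G$ and density $g$, the quantile function is $Q_X(v)=\inf\{x: G(x)\ge v\}$, $0\le v\le 1$, and the quantile density function is $q_X(v)=\frac{d}{dv}Q_X(v)$; it satisfies $q_X(v)\,g(Q_X(v))=1$. For $\eta>0$ the dynamic quantile-based fractional generalized cumulative past entropy (DQFGCPE) of $X$ is $$\mathcal{C}\mathcal{P}\xi_Q^\eta(X,v)=\frac{1}{v\,\Gamma(\eta+1)}\int_0^v p\,[\ln v-\ln p]^\eta q_X(p)\,dp,\qquad v\in(0,1)$$ (integral assumed finite). A random variable $X$ is IDQFGCPE (respectively, DDQFGCPE) if $\mathcal{C}\mathcal{P}\xi_Q^\eta(X,v)$ is increasing (respectively, decreasing) in $v$; $\eta>0$ is fixed. *)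

(* Defs.v *)
From HB Require Import structures.
From mathcomp Require Import all_boot all_order all_algebra.
From mathcomp Require Import all_classical all_reals all_analysis.
Import Order.TTheory GRing.Theory Num.Theory.
Import numFieldNormedType.Exports.

Set Implicit Arguments.
Unset Strict Implicit.
Unset Printing Implicit Defensive.

Local Open Scope classical_set_scope.
Local Open Scope ring_scope.

(* Meaningful for s > 0, where the integral is finite. *)
Definition Gamma (R : realType) (s : R) : R :=
  \int[lebesgue_measure]_(x in `]0, +oo[) (x `^ (s - 1) * expR (- x)).

(* [inf] is real-valued, so this is the quantile function only for 0 < v < 1:
   the set is unbounded below for v = 0 and may be empty for v = 1. *)
Definition quantile d (T : measurableType d) (R : realType)
    (P : probability T R) (X : {RV P >-> R}) (v : R) : R :=
  inf [set x | (v%:E <= cdf X x)%E].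

Definition quantile_density d (T : measurableType d) (R : realType)
    (P : probability T R) (X : {RV P >-> R}) : R -> R :=
  derive1 (quantile X).

(* The value is +oo when the integral diverges. *)
Definition DQFGCPE d (T : measurableType d) (R : realType)
    (P : probability T R) (X : {RV P >-> R}) (eta v : R) : \bar R :=
  (((v * Gamma (eta + 1))^-1)%:E *
   \int[lebesgue_measure]_(p in `]0%R, v[)
     (p * (ln v - ln p) `^ eta * quantile_density X p)%R%:E)%E.

Definition IDQFGCPE d (T : measurableType d) (R : realType)
    (P : probability T R) (X : {RV P >-> R}) (eta : R) : Prop :=
  forall u v : R, 0 < u -> u <= v -> v < 1 ->
    (DQFGCPE X eta u <= DQFGCPE X eta v)%E.

Definition DDQFGCPE d (T : measurableType d) (R : realType)
    (P : probability T R) (X : {RV P >-> R}) (eta : R) : Prop :=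
  forall u v : R, 0 < u -> u <= v -> v < 1 ->
    (DQFGCPE X eta v <= DQFGCPE X eta u)%E.

Definition concave_function (R : realType) (D : set R) (f : R -> R) : Prop :=
  convex_function (E := R^o) D (\- f).

(* Main.v *)
Require Import Defs.
From HB Require Import structures.
From mathcomp Require Import all_boot all_order all_algebra.
From mathcomp Require Import all_classical all_reals all_analysis.
From mathcomp Require Import measurable_realfun ring lra.
Import Order.TTheory GRing.Theory Num.Theory.
Import numFieldNormedType.Exports.

Local Open Scope classical_set_scope.
Local Open Scope ring_scope.

(** Put k_v(p) = (p / v) (ln v - ln p)^eta for p < v and k_v(p) = 0 otherwise.
    Up to the constant Gamma(eta + 1), the entropy of X at v is the integral of
    k_v q_X over ]0, 1[.  On ]0, 1[ the quantile function of Y = Psi(X) is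
    Psi o Q_X ([quantile_comp]), so that q_Y = phi q_X with
    phi = Psi' o Q_X >= 0, and phi is nondecreasing when Psi is convex,
    nonincreasing when Psi is concave.  The theorem is therefore about what
    happens to the comparison of two integrals, of k_u q_X and of k_v q_X, when
    both are reweighted by a monotone function phi.

    The point is that for u < v the difference k_v - k_u changes sign once: it is
    nonpositive before some m in ]0, u[ and nonnegative after it
    ([past_kernel_crossing]).  When phi is nondecreasing, phi - phi(m) has the
    same sign pattern, hence
        (k_v - k_u) (phi - phi(m)) q_X >= 0,
    and integrating,
        int (k_v - k_u) phi q_X >= phi(m) int (k_v - k_u) q_X,
    whose right-hand side is nonnegative when X is IDQFGCPE.  In the concave case
    phi - phi(m) has the opposite sign pattern, and the same argument applies
    with u and v exchanged.  The general form of this argument is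
    [le_integral_reweight]. *)

(** * Derivatives of monotone and convex functions *)

Section derivative.
Context {R : realType}.
Implicit Types (f g : R -> R) (x c : R) (D : set R).

Lemma cvg_slope f x : derivable f x 1 ->
  h^-1 * (f (h + x) - f x) @[h --> 0^'] --> derive1 f x.
Proof.
move=> df; rewrite derive1E.
have : h^-1 *: ((f \o shift x) (h *: 1) - f x) @[h --> 0^'] --> 'D_1 f x by [].
by under eq_fun do rewrite /= /shift/= [_ *: 1]mulr1.
Qed.

Lemma le_derive1_right f x c : derivable f x 1 ->
  (\forall h \near 0^'+, h * c <= f (h + x) - f x) -> c <= derive1 f x.
Proof.
move=> /cvg_slope /cvg_dnbhs_at_right fx hc.
rewrite -(cvg_lim _ fx)//; apply: limr_ge; first by apply/cvg_ex; exists (derive1 f x).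
near=> h; have h0 : 0 < h by near: h; exact: nbhs_right_gt.
by rewrite mulrC ler_pdivlMr// mulrC; near: h.
Unshelve. all: by end_near. Qed.

Lemma le_derive1_left f x c : derivable f x 1 ->
  (\forall h \near 0^'-, f (h + x) - f x <= h * c) -> c <= derive1 f x.
Proof.
move=> /cvg_slope /cvg_dnbhs_at_left fx hc.
rewrite -(cvg_lim _ fx)//; apply: limr_ge; first by apply/cvg_ex; exists (derive1 f x).
near=> h; have h0 : h < 0 by near: h; exact: nbhs_left_lt.
by rewrite mulrC ler_ndivlMr// mulrC; near: h.
Unshelve. all: by end_near. Qed.

Lemma nondecreasing_derive1_ge0 f x (b : R) : x < b ->
  (forall y, x <= y -> y < b -> f x <= f y) -> derivable f x 1 -> 0 <= derive1 f x.
Proof.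
move=> xb fnd df; apply: le_derive1_right => //; near=> h.
rewrite mulr0 subr_ge0; apply: fnd.
  by rewrite lerDr; near: h; exact: nbhs_right_ge.
by rewrite -ltrBrDr; near: h; apply: nbhs_right_lt; rewrite subr_gt0.
Unshelve. all: by end_near. Qed.

(** Convexity in cross-multiplied form, with the intermediate point z in place of
    the barycentric parameter: it is used with z close to one of the endpoints. *)
Lemma convex_function_chord f x y z : convex_function (E := R^o) `[0, +oo[ f ->
  0 <= x -> x < y -> x <= z -> z <= y ->
  (y - x) * f z <= (y - z) * f x + (z - x) * f y.
Proof.
move=> cf x0 xy xz zy.
have yx0 : 0 < y - x by rewrite subr_gt0.
have t01 : 0 <= (y - z) / (y - x) <= 1.
  rewrite ler_pdivrMr// mul1r lerD2l lerN2 xz andbT.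
  by rewrite divr_ge0// ?subr_ge0// ltW.
have [t0 t1] := andP t01.
have := cf (Itv01 t0 t1) x y; rewrite !inE/= !in_itv/= !andbT => /(_ x0).
have yxn : y - x != 0 by rewrite gt_eqF.
set w := conv _ _ _; have {w}-> : w = z.
  transitivity ((y - z) / (y - x) * x + (1 - (y - z) / (y - x)) * y) => //.
  by field.
move=> /(_ (ltW (le_lt_trans x0 xy))) cfz.
have {}cfz : f z <= (y - z) / (y - x) * f x + (1 - (y - z) / (y - x)) * f y.
  exact: cfz.
move: cfz; rewrite -(ler_pM2l yx0) => /le_trans; apply.
by rewrite le_eqVlt; apply/orP; left; apply/eqP; field.
Qed.

(** The slope s of the chord from x to y separates the two derivatives: the graph
    lies below the chord, so it leaves x with slope at most s and reaches y with
    slope at least s. *)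
Lemma convex_derive1_nondecreasing f x y :
  convex_function (E := R^o) `[0, +oo[ f ->
  (forall z, 0 < z -> derivable f z 1) ->
  0 < x -> x <= y -> derive1 f x <= derive1 f y.
Proof.
move=> cf df x0; rewrite le_eqVlt => /predU1P[->//|xy].
have y0 := lt_trans x0 xy.
pose s := (f y - f x) / (y - x).
have yx0 : 0 < y - x by rewrite subr_gt0.
have yxn : y - x != 0 by rewrite gt_eqF.
have fyE : f y = s * (y - x) + f x by rewrite /s divfK// subrK.
apply: (@le_trans _ _ s).
- rewrite -lerN2.
  have -> : - derive1 f x = derive1 (\- f) x by rewrite !derive1E deriveN//; exact: df.
  apply: le_derive1_right; first by apply: derivableN; exact: df.
  near=> h.
  have h0 : 0 < h by near: h; exact: nbhs_right_gt.
  have hy : h < y - x by near: h; exact: nbhs_right_lt.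
  have := convex_function_chord f x y (h + x) cf (ltW x0) xy.
  rewrite lerDr (ltW h0) -lerBrDr (ltW hy) => /(_ isT isT).
  rewrite /= opprK fyE => H; rewrite -(ler_pM2l yx0); nra.
- apply: le_derive1_left; first exact: df.
  near=> h.
  have h0 : h < 0 by near: h; exact: nbhs_left_lt.
  have hx : x - y < h by near: h; apply: nbhs_left_gt; rewrite subr_lt0.
  have := convex_function_chord f x y (h + y) cf (ltW x0) xy.
  rewrite gerDr (ltW h0) -lerBlDr (ltW hx) => /(_ isT isT).
  rewrite fyE => H; rewrite -(ler_pM2l yx0); nra.
Unshelve. all: by end_near. Qed.

(** The derivative is the pointwise limit of the difference quotients of step
    1/(n+1).  Extending f by 0 outside D makes these quotients measurable on the
    whole line; as D is open, this changes neither f near a point of D nor its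
    derivative there. *)
Lemma measurable_fun_derive1 D f : open D ->
  (forall x, D x -> derivable f x 1) -> measurable_fun D (derive1 f).
Proof.
move=> oD df; have mD : measurable D by exact: open_measurable.
have mf : measurable_fun setT (f \_ D).
  apply/(measurable_restrictT _ _).1 => //.
  apply: open_continuous_measurable_fun => // x /set_mem Dx.
  exact/differentiable_continuous/derivable1_diffP/df.
pose slope n x := n.+1%:R * ((f \_ D) (n.+1%:R^-1 + x) - (f \_ D) x).
apply: (@measurable_fun_cvg _ _ _ _ slope).
  move=> n; apply: (measurable_funS measurableT) => //.
  apply: measurable_funM => //; apply: measurable_funB => //.
  apply: measurableT_comp => //; exact: measurable_funD.
move=> x Dx.
have fDf : {near x, f \_ D =1 f}.
  have : \forall y \near x, D y by exact: open_nbhs_nbhs.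
  by apply: filterS => y Dy; rewrite patchE mem_set.
have dfD : derivable (f \_ D) x 1.
  apply: (@near_eq_derivable _ _ _ f); last exact: df.
  by apply: filterS fDf => y ->.
have := cvg_slope _ _ dfD.
rewrite derive1E (near_eq_derive _ fDf) -derive1E.
move=> /cvg_dnbhs_at_right /cvg_at_rightP/(_ (fun n => n.+1%:R^-1)) H.
have {}H := H (conj _ _).
have -> : slope ^~ x = fun n => (n.+1%:R^-1)^-1 *
    ((f \_ D) (n.+1%:R^-1 + x) - (f \_ D) x).
  by apply/funext => n; rewrite invrK.
apply: H; first by move=> n; rewrite invr_gt0.
exact: cvg_harmonic.
Qed.

End derivative.

(** * Quantile functions *)

Section quantile.
Context d (T : measurableType d) (R : realType) (P : probability T R).
Implicit Types (X Y : {RV P >-> R}) (u v x y : R).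

(** The Galois connection between the quantile and distribution functions.  The
    limits of the distribution function at infinity make the infimum a genuine
    one for 0 < v < 1, and right continuity makes it attained. *)
Lemma quantile_le X v x : 0 < v < 1 ->
  (quantile X v <= x) = (v%:E <= cdf X x)%E.
Proof.
move=> /andP[v0 v1]; set S := [set z | (v%:E <= cdf X z)%E].
(* Otherwise the distribution function would stay below v < 1. *)
have S0 : S !=set0.
  apply/set0P/eqP => S0.
  have : (1%:E <= v%:E :> \bar R)%E.
    rewrite -(cvg_lim _ (cvg_cdfy1 X))//.
    apply: lime_le; first by apply/cvg_ex; exists 1%E; exact: cvg_cdfy1.
    apply: nearW => z; rewrite leNgt; apply/negP => /ltW vz.
    by have : S z by []; rewrite S0.
  by rewrite lee_fin leNgt v1.
(* Otherwise the distribution function would stay above v > 0. *)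
have Slb : has_lbound S.
  apply: contrapT => nlb.
  have : (v%:E <= 0%E :> \bar R)%E.
    rewrite -(cvg_lim _ (cvg_cdfNy0 X))//.
    apply: lime_ge; first by apply/cvg_ex; exists 0%E; exact: cvg_cdfNy0.
    apply: nearW => z; rewrite leNgt; apply/negP => zv.
    apply: nlb; exists z => s Ss; rewrite leNgt; apply/negP => sz.
    have := le_lt_trans (cdf_nondecreasing X (ltW sz)) zv.
    by rewrite ltNge => /negP; apply.
  by rewrite lee_fin leNgt v0.
have SQ : S (quantile X v).
  rewrite /S/= -(cvg_lim _ (@cdf_right_continuous _ _ _ _ X (quantile X v)))//.
  apply: lime_ge.
    apply/cvg_ex; exists (cdf X (quantile X v)); exact: cdf_right_continuous.
  near=> z.
  have /(inf_lt S0)[s Ss sz] : quantile X v < z.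
    by near: z; exact: nbhs_right_gt.
  by rewrite (le_trans Ss)// cdf_nondecreasing// ltW.
apply/idP/idP => [Qx|vx]; last exact: ge_inf.
by rewrite (le_trans SQ)// cdf_nondecreasing.
Unshelve. all: by end_near. Qed.

Lemma quantile_nondecreasing X u v : 0 < u -> u <= v -> v < 1 ->
  quantile X u <= quantile X v.
Proof.
move=> u0 uv v1; rewrite quantile_le ?u0 ?(le_lt_trans uv)//.
apply: (@le_trans _ _ v%:E); first by rewrite lee_fin.
by rewrite -quantile_le ?lexx// v1 (lt_le_trans u0 uv).
Qed.

(** A nonnegative X without an atom at 0 has a distribution function vanishing
    at 0, so 0 cannot be a quantile of positive order. *)
Lemma quantile_gt0 X v : (forall w, 0 <= X w) ->
  distribution P X `<< lebesgue_measure -> 0 < v < 1 -> 0 < quantile X v.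
Proof.
move=> X0 Xac v01; rewrite ltNge quantile_le// -ltNge.
have -> : cdf X 0 = 0%E.
  have -> : cdf X 0 = distribution P X [set 0].
    rewrite /cdf /distribution /pushforward; congr (P _).
    apply/seteqP; split => w /=; rewrite in_itv/=; last by move=> ->.
    by move=> Xw0; apply/eqP; rewrite eq_le Xw0 X0.
  have /null_content_dominatesP := Xac; apply=> //.
  exact: lebesgue_measure_set1.
by rewrite lte_fin; case/andP: v01.
Qed.

(** Monotonicity of Psi gives the inequality <=.  Continuity gives the other one:
    if Q_Y(v) < Psi(Q_X(v)), then Q_Y(v) < Psi(x) for some x < Q_X(v), so that
    Y <= Q_Y(v) forces X <= x, an event of probability less than v. *)
Lemma quantile_comp X Y (Psi : R -> R) v : (forall w, 0 <= X w) ->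
  (forall w, Y w = Psi (X w)) ->
  (forall x y, 0 <= x -> x <= y -> Psi x <= Psi y) ->
  0 < v < 1 -> 0 < quantile X v -> {for quantile X v, continuous Psi} ->
  quantile Y v = Psi (quantile X v).
Proof.
move=> X0 YE Psi_nd v01 Q0 cPsi.
have cdf_le X1 X2 x y : X1 @^-1` `]-oo, x] `<=` X2 @^-1` `]-oo, y] ->
    (cdf X1 x <= cdf X2 y)%E.
  move=> ?; rewrite /cdf /distribution /pushforward.
  by apply: (le_measure P) => //; rewrite inE; exact: measurable_funPTI.
apply/eqP; rewrite eq_le; apply/andP; split.
  rewrite quantile_le// (@le_trans _ _ (cdf X (quantile X v)))//.
    by rewrite -quantile_le.
  by apply: cdf_le => w /=; rewrite !in_itv/= YE; exact: Psi_nd.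
rewrite leNgt; apply/negP => QY.
have [x [x0 xQ QYx]] : exists x,
    [/\ 0 <= x, x < quantile X v & quantile Y v < Psi x].
  have PsiQ := cvg_at_left_filter cPsi.
  near ((quantile X v)^'-) => x; exists x; split.
  - by apply: ltW; near: x; exact: nbhs_left_gt.
  - by near: x; exact: nbhs_left_lt.
  - by near: x; exact: cvgr_gt PsiQ _ QY.
have : (cdf Y (quantile Y v) <= cdf X x)%E.
  apply: cdf_le => w /=; rewrite !in_itv/= YE => PsiX.
  rewrite leNgt; apply/negP => xX.
  have := le_lt_trans (le_trans (Psi_nd _ _ x0 (ltW xX)) PsiX) QYx.
  by rewrite ltxx.
have : (v%:E <= cdf Y (quantile Y v))%E by rewrite -quantile_le.
move=> /le_trans /[apply]; rewrite -quantile_le//.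
by rewrite leNgt xQ.
Unshelve. all: by end_near. Qed.

End quantile.

(** * The entropy kernel and reweighting of integrals *)

Section kernel.
Context {R : realType}.
Implicit Types (eta u v p : R).

(** The cutoff at v lets all the integrals range over ]0, 1[; without it, the
    formula would not vanish beyond v, as [powR] is 1 on negative bases. *)
Definition past_kernel eta v p : R :=
  if p < v then p / v * (ln v - ln p) `^ eta else 0.

Lemma past_kernel_ge0 eta v p : 0 < v -> 0 <= p -> 0 <= past_kernel eta v p.
Proof.
move=> v0 p0; rewrite /past_kernel; case: ifP => // _.
by rewrite mulr_ge0 ?powR_ge0// divr_ge0// ltW.
Qed.

Lemma measurable_past_kernel eta v D : measurable_fun D (past_kernel eta v).
Proof.
apply: (measurable_funS measurableT) => //.
apply: measurable_fun_ifT => //; first exact: measurable_fun_ltr.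
apply: measurable_funM; first exact: measurable_funM.
apply: (@measurableT_comp _ _ _ _ _ _ (fun x => x `^ eta)).
  exact: measurable_powR.
by apply: measurable_funB => //; exact: measurable_ln.
Qed.

(** For p < u the ratio of the two kernels is
    (u / v) ((ln v - ln p) / (ln u - ln p))^eta, which increases with p from
    u / v < 1 to +oo, so it crosses 1 exactly once; between u and v only the
    kernel at v is positive.  The crossing point m solves
    ln v - ln p = r (ln u - ln p) with r^eta = v / u. *)
Lemma past_kernel_crossing eta u v : 0 < eta -> 0 < u -> u < v ->
  exists m, [/\ 0 < m, m < u,
    forall p, 0 < p -> p <= m -> past_kernel eta v p <= past_kernel eta u p &
    forall p, m <= p -> past_kernel eta u p <= past_kernel eta v p].
Proof.
move=> eta0 u0 uv; have v0 := lt_trans u0 uv.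
have lnuv : ln u < ln v by rewrite ltr_ln ?posrE.
pose r := (v / u) `^ eta^-1.
have rE : r `^ eta = v / u.
  by rewrite /r -powRrM mulVf ?gt_eqF// powRr1// divr_ge0// ltW.
have r1 : 1 < r.
  have <- : 1 `^ eta^-1 = 1 :> R by rewrite powR1.
  apply: gt0_ltr_powR; rewrite ?invr_gt0//.
  - by rewrite nnegrE.
  - by rewrite nnegrE divr_ge0// ltW.
  - by rewrite ltr_pdivlMr// mul1r.
have r10 : 0 < r - 1 by rewrite subr_gt0.
pose m := expR ((r * ln u - ln v) / (r - 1)).
have lnm : (r - 1) * ln m = r * ln u - ln v.
  by rewrite /m expRK mulrC divfK// gt_eqF.
have m0 : 0 < m by exact: expR_gt0.
have mu : m < u.
  by rewrite -ltr_ln ?posrE// -(ltr_pM2l r10) lnm; lra.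
have scale p : 0 < p -> p < u ->
    p / v * (r * (ln u - ln p)) `^ eta = p / u * (ln u - ln p) `^ eta.
  move=> p0 pu; have lnpu : ln p < ln u by rewrite ltr_ln ?posrE.
  rewrite powRM ?rE; [|exact/ltW/(lt_trans ltr01)|by rewrite subr_ge0 ltW].
  by field; rewrite !gt_eqF.
exists m; split=> // [p p0 pm|p mp].
- have pu := le_lt_trans pm mu; have pv := lt_trans pu uv.
  have lnpu : ln p < ln u by rewrite ltr_ln ?posrE.
  rewrite /past_kernel pu pv -scale//.
  rewrite ler_pM2l ?divr_gt0//; apply: ge0_ler_powR; rewrite ?nnegrE.
  + exact: ltW.
  + lra.
  + by rewrite mulr_ge0 ?subr_ge0 ?ltW//; exact: lt_trans r1.
  + have : (r - 1) * ln p <= (r - 1) * ln m by rewrite ler_pM2l// ler_ln ?posrE.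
    by rewrite lnm; lra.
- have p0 := lt_le_trans m0 mp.
  rewrite {1}/past_kernel; case: ifPn => [pu|_]; last first.
    by rewrite past_kernel_ge0// ltW.
  have pv := lt_trans pu uv.
  have lnpu : ln p < ln u by rewrite ltr_ln ?posrE.
  rewrite /past_kernel pv -scale//.
  rewrite ler_pM2l ?divr_gt0//; apply: ge0_ler_powR; rewrite ?nnegrE.
  + exact: ltW.
  + by rewrite mulr_ge0 ?subr_ge0 ?ltW//; exact: lt_trans r1.
  + lra.
  + have : (r - 1) * ln m <= (r - 1) * ln p by rewrite ler_pM2l// ler_ln ?posrE.
    by rewrite lnm; lra.
Qed.

End kernel.

(** If k2 - k1 and phi - c have the same sign on D and the integral of k1 q is at
    most that of k2 q, then this remains true after reweighting q by phi.
    The sign hypothesis is integrated in the form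
    k1 phi q + c k2 q <= k2 phi q + c k1 q, where all the terms are nonnegative;
    the integral of c k2 q is cancelled at the end. *)
Lemma le_integral_reweight d (T : measurableType d) (R : realType)
    (mu : {measure set T -> \bar R}) (D : set T) (k1 k2 q phi : T -> R) (c : R) :
  measurable D -> measurable_fun D k1 -> measurable_fun D k2 ->
  measurable_fun D q -> measurable_fun D (phi \* q) ->
  (forall x, D x -> 0 <= k1 x) -> (forall x, D x -> 0 <= k2 x) ->
  (forall x, D x -> 0 <= q x) -> (forall x, D x -> 0 <= phi x) -> 0 <= c ->
  (forall x, D x -> 0 <= (k2 x - k1 x) * (phi x - c)) ->
  (\int[mu]_(x in D) (k2 x * q x)%:E < +oo)%E ->
  (\int[mu]_(x in D) (k1 x * q x)%:E <= \int[mu]_(x in D) (k2 x * q x)%:E)%E ->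
  (\int[mu]_(x in D) (k1 x * (phi x * q x))%:E <=
   \int[mu]_(x in D) (k2 x * (phi x * q x))%:E)%E.
Proof.
move=> mD mk1 mk2 mq mpq k10 k20 q0 phi0 c0 cross fin le12.
have mE (k h : T -> R) : measurable_fun D k -> measurable_fun D h ->
    measurable_fun D (fun x => (k x * h x)%:E).
  by move=> mk mh; apply/measurable_EFinP; exact: measurable_funM.
have mcE (k : T -> R) : measurable_fun D k ->
    measurable_fun D (fun x => (c%:E * (k x * q x)%:E)%E).
  by move=> mk; apply: emeasurable_funM => //; exact: mE.
have ge0 (k : T -> R) : (forall x, D x -> 0 <= k x) ->
    forall x, D x -> (0 <= (k x * q x)%:E)%E.
  by move=> k0 x Dx; rewrite lee_fin mulr_ge0// ?k0 ?q0.
have gep0 (k : T -> R) : (forall x, D x -> 0 <= k x) ->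
    forall x, D x -> (0 <= (k x * (phi x * q x))%:E)%E.
  by move=> k0 x Dx; rewrite lee_fin !mulr_ge0// ?k0 ?q0 ?phi0.
have gec0 (k : T -> R) : (forall x, D x -> 0 <= k x) ->
    forall x, D x -> (0 <= c%:E * (k x * q x)%:E)%E.
  by move=> k0 x Dx; rewrite mule_ge0// ge0.
have sum (k k' : T -> R) : measurable_fun D k -> measurable_fun D k' ->
    (forall x, D x -> 0 <= k x) -> (forall x, D x -> 0 <= k' x) ->
    (\int[mu]_(x in D) ((k x * (phi x * q x))%:E + c%:E * (k' x * q x)%:E) =
     \int[mu]_(x in D) (k x * (phi x * q x))%:E +
     c%:E * \int[mu]_(x in D) (k' x * q x)%:E)%E.
  move=> mk mk' k0 k'0.
  rewrite ge0_integralD//; [|exact: gep0|exact: mE|exact: gec0|exact: mcE].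
  by rewrite ge0_integralZl_EFin//; [exact: ge0|exact: mE].
have : (\int[mu]_(x in D) ((k1 x * (phi x * q x))%:E + c%:E * (k2 x * q x)%:E) <=
  \int[mu]_(x in D) ((k2 x * (phi x * q x))%:E + c%:E * (k1 x * q x)%:E))%E.
  apply: ge0_le_integral => //.
  - by move=> x Dx; rewrite adde_ge0// ?gep0 ?gec0.
  - by apply: emeasurable_funD; [exact: mE|exact: mcE].
  - by apply: emeasurable_funD; [exact: mE|exact: mcE].
  - move=> x Dx; rewrite -!EFinM -!EFinD lee_fin -subr_ge0.
    have := mulr_ge0 (cross _ Dx) (q0 _ Dx).
    by congr (0 <= _); ring.
rewrite !sum// => le_sum.
have fin2 : (\int[mu]_(x in D) (k2 x * q x)%:E)%E \is a fin_num.
  by rewrite ge0_fin_numE// integral_ge0//; exact: ge0.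
rewrite -(@leeD2rE _ (c%:E * \int[mu]_(x in D) (k2 x * q x)%:E)%E) ?fin_numM//.
by apply: (le_trans le_sum); rewrite leeD2l// lee_wpmul2l.
Qed.

(** * Monotonicity of the entropy under reweighting of the quantile density *)

(** Transfers a comparison through a common factor g >= 0, here the inverse of
    Gamma(eta + 1).  When g = 0 nothing can be cancelled, but both sides of the
    conclusion vanish. *)
Lemma lee_mul2l_transfer (R : realType) (g : R) (I1 I2 J1 J2 : \bar R) :
  0 <= g -> (0 <= J2)%E ->
  (g%:E * J2 < +oo)%E -> (g%:E * J1 <= g%:E * J2)%E ->
  ((J2 < +oo)%E -> (J1 <= J2)%E -> (I1 <= I2)%E) ->
  (g%:E * I1 <= g%:E * I2)%E.
Proof.
move=> g_ge0 J20 fin leJ leI.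
have [->|g_neq0] := eqVneq g 0; first by rewrite !mul0e.
have g0 : 0 < g by rewrite lt_neqAle eq_sym g_neq0.
rewrite lee_pmul2l//; apply: leI; last by move: leJ; rewrite lee_pmul2l.
by rewrite -(@lte_pmul2l _ g%:E)// gt0_muley.
Qed.

Section DQFGCPE.
Context d (T : measurableType d) (R : realType) (P : probability T R).
Implicit Types (X Y : {RV P >-> R}) (u v eta : R).

Lemma quantile_density_ge0 X v :
  (forall u, 0 < u < 1 -> derivable (quantile X) u 1) -> 0 < v < 1 ->
  0 <= quantile_density X v.
Proof.
move=> dQ v01; have [v0 v1] := andP v01.
apply: (nondecreasing_derive1_ge0 _ _ _ v1); last exact: dQ.
by move=> y vy y1; exact: quantile_nondecreasing.
Qed.

Lemma measurable_quantile_density X :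
  (forall u, 0 < u < 1 -> derivable (quantile X) u 1) ->
  measurable_fun (`]0, 1[ : set R) (quantile_density X).
Proof.
by move=> dQ; exact: measurable_fun_derive1.
Qed.

Lemma Gamma_ge0 (s : R) : 0 <= Gamma s.
Proof. by apply: Rintegral_ge0 => x _; rewrite mulr_ge0 ?powR_ge0 ?expR_ge0. Qed.

Lemma DQFGCPE_kernel X eta v :
  (forall u, 0 < u < 1 -> derivable (quantile X) u 1) -> 0 < v < 1 ->
  DQFGCPE X eta v = ((Gamma (eta + 1))^-1%:E *
    \int[lebesgue_measure]_(p in `]0%R, 1%R[)
      (past_kernel eta v p * quantile_density X p)%:E)%E.
Proof.
move=> dQ v01; have [v0 v1] := andP v01.
have subv : `]0, v[ `<=` (`]0, 1[ : set R) by apply: subset_itvl; rewrite bnd_simp ltW.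
rewrite /DQFGCPE invfM mulrC EFinM -muleA; congr (_ * _)%E.
rewrite -ge0_integralZl_EFin//; last 3 first.
- move=> p pv; have /= := subv _ pv; rewrite in_itv/= => p01.
  rewrite lee_fin !mulr_ge0 ?powR_ge0 ?quantile_density_ge0//.
  by case/andP: p01 => /ltW.
- apply/measurable_EFinP; apply: measurable_funM; last first.
    by apply: (measurable_funS _ subv) => //; exact: measurable_quantile_density.
  apply: (measurable_funS measurableT) => //.
  apply: measurable_funM => //.
  apply: (@measurableT_comp _ _ _ _ _ _ (fun x => x `^ eta)).
    exact: measurable_powR.
  by apply: measurable_funB => //; exact: measurable_ln.
- by rewrite invr_ge0 ltW.
have -> : `]0, v[%classic = `]0, 1[ `&` `]-oo, v[ :> set R.
  apply/seteqP; split => p /=; rewrite !in_itv/=.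
    by move=> /andP[-> pv]; rewrite pv (lt_trans pv).
  by move=> [/andP[-> _] ->].
rewrite integral_mkcondr; apply: eq_integral => p _.
rewrite patchE mem_setE in_itv/= /past_kernel.
case: ifPn => _; last by rewrite mul0r.
by rewrite -EFinM; congr (_%:E); ring.
Qed.

(** The order of u and v is left open: a nondecreasing phi calls for u < v, a
    nonincreasing one for v < u, with c the value of phi at the crossing point of
    the two kernels in both cases. *)
Lemma le_DQFGCPE_reweight X Y (phi : R -> R) (c : R) eta u v :
  (forall p, 0 < p < 1 -> derivable (quantile X) p 1) ->
  (forall p, 0 < p < 1 -> derivable (quantile Y) p 1) ->
  (forall p, 0 < p < 1 ->
    quantile_density Y p = phi p * quantile_density X p) ->
  (forall p, 0 < p < 1 -> 0 <= phi p) -> 0 <= c ->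
  (forall p, 0 < p < 1 ->
    0 <= (past_kernel eta v p - past_kernel eta u p) * (phi p - c)) ->
  0 < u < 1 -> 0 < v < 1 -> (DQFGCPE X eta v < +oo)%E ->
  (DQFGCPE X eta u <= DQFGCPE X eta v)%E ->
  (DQFGCPE Y eta u <= DQFGCPE Y eta v)%E.
Proof.
move=> dQX dQY qYE phi0 c0 cross u01 v01.
have DYE w : 0 < w < 1 -> DQFGCPE Y eta w = ((Gamma (eta + 1))^-1%:E *
    \int[lebesgue_measure]_(p in `]0%R, 1%R[)
      (past_kernel eta w p * (phi p * quantile_density X p))%:E)%E.
  move=> w01; rewrite (DQFGCPE_kernel Y eta w dQY w01); congr (_ * _)%E.
  by apply: eq_integral => p; rewrite mem_setE => p01; rewrite qYE.
rewrite (DQFGCPE_kernel X eta u dQX u01) (DQFGCPE_kernel X eta v dQX v01).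
rewrite (DYE u u01) (DYE v v01) => fin le_uv.
have kernel_ge0 w p : 0 < w < 1 -> p \in `]0, 1[ -> 0 <= past_kernel eta w p.
  move=> /andP[w0 _]; rewrite in_itv/= => /andP[p0 _].
  by rewrite past_kernel_ge0// ltW.
have q_ge0 p : p \in `]0, 1[ -> 0 <= quantile_density X p.
  by rewrite in_itv/=; exact: (quantile_density_ge0 X p dQX).
apply: (@lee_mul2l_transfer _ _ _ _ _ _ _ _ fin le_uv).
- by rewrite invr_ge0 Gamma_ge0.
- by apply: integral_ge0 => p p01; rewrite lee_fin mulr_ge0 ?kernel_ge0 ?q_ge0.
move=> {}fin {}le_uv.
apply: (@le_integral_reweight _ _ _ _ _ _ _ _ _ c) => //.
- exact: measurable_past_kernel.
- exact: measurable_past_kernel.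
- exact: (measurable_quantile_density X dQX).
- apply: eq_measurable_fun (measurable_quantile_density _ dQY) => p.
  by rewrite mem_setE => p01; rewrite qYE.
- by move=> p /=; exact: kernel_ge0.
- by move=> p /=; exact: kernel_ge0.
Qed.

End DQFGCPE.

Theorem theorem3p2 (R : realType) (d : measure_display) (T : measurableType d)
  (P : probability T R) (X Y : {RV P >-> R}) (Psi : R -> R) (eta : R)
  (eta_gt0 : 0 < eta)
  (X_ge0 : forall w : T, 0 <= X w)
  (X_ac : distribution P X `<< lebesgue_measure)
  (QX_derivable : forall v : R, 0 < v < 1 -> derivable (quantile X) v 1)
  (Psi_ge0 : forall x : R, 0 <= x -> 0 <= Psi x)
  (Psi_nondecreasing : forall x y : R, 0 <= x -> x <= y -> Psi x <= Psi y)
  (Psi_derivable : forall x : R, 0 < x -> derivable Psi x 1)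
  (Y_def : forall w : T, Y w = Psi (X w))
  (X_fin : forall v : R, 0 < v < 1 -> (DQFGCPE X eta v < +oo)%E)
  (Y_fin : forall v : R, 0 < v < 1 -> (DQFGCPE Y eta v < +oo)%E) :
  (convex_function (E := R^o) `[0, +oo[ Psi ->
     IDQFGCPE X eta -> IDQFGCPE Y eta) /\
  (concave_function `[0, +oo[ Psi ->
     DDQFGCPE X eta -> DDQFGCPE Y eta).
Proof.
have QX_gt0 (v : R) : 0 < v < 1 -> 0 < quantile X v by exact: quantile_gt0.
have QYE (v : R) : 0 < v < 1 -> quantile Y v = Psi (quantile X v).
  move=> v01; apply: quantile_comp => //; first exact: QX_gt0.
  exact/differentiable_continuous/derivable1_diffP/Psi_derivable/QX_gt0.
have near_QYE (v : R) : 0 < v < 1 -> {near v, quantile Y =1 Psi \o quantile X}.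
  move=> v01; have /near_in_itvoo : v \in `]0, 1[ by rewrite in_itv.
  by apply: filterS => w; rewrite in_itv/= => /QYE.
have derivable_comp (v : R) : 0 < v < 1 -> derivable (Psi \o quantile X) v 1.
  move=> v01; apply/derivable1_diffP; apply: differentiable_comp.
    exact/derivable1_diffP/QX_derivable.
  exact/derivable1_diffP/Psi_derivable/QX_gt0.
have QY_derivable (v : R) : 0 < v < 1 -> derivable (quantile Y) v 1.
  move=> v01; apply: near_eq_derivable (derivable_comp _ v01).
  by apply: filterS (near_QYE _ v01).
pose phi v := derive1 Psi (quantile X v).
have qYE (v : R) : 0 < v < 1 ->
    quantile_density Y v = phi v * quantile_density X v.
  move=> v01; rewrite /quantile_density derive1E.
  rewrite (near_eq_derive _ (near_QYE _ v01)).
  rewrite -derive1E derive1_comp//; first exact: QX_derivable.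
  exact/Psi_derivable/QX_gt0.
have phi_ge0 (v : R) : 0 < v < 1 -> 0 <= phi v.
  move=> v01; have Q0 := QX_gt0 _ v01.
  apply: (@nondecreasing_derive1_ge0 _ _ _ (quantile X v + 1)).
  - by rewrite ltrDl.
  - by move=> y Qy _; apply: Psi_nondecreasing => //; exact: ltW.
  - exact: Psi_derivable.
split=> [cPsi incX|cPsi decX] u v u0; rewrite le_eqVlt => /predU1P[->//|uv] v1.
- have v01 : 0 < v < 1 by rewrite (lt_trans u0 uv).
  have u01 : 0 < u < 1 by rewrite u0 (lt_trans uv).
  have [m [m0 mu below above]] := past_kernel_crossing _ _ _ eta_gt0 u0 uv.
  have m01 : 0 < m < 1 by rewrite m0 (lt_trans mu)//; case/andP: u01.
  have phi_mono (p q : R) : 0 < p -> p <= q -> q < 1 -> phi p <= phi q.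
    move=> p0 pq q1; apply: convex_derive1_nondecreasing => //.
      by apply: QX_gt0; rewrite p0 (le_lt_trans pq).
    exact: quantile_nondecreasing.
  apply: (le_DQFGCPE_reweight _ _ _ _ X Y phi (phi m) _ _ _
    QX_derivable QY_derivable qYE phi_ge0 (phi_ge0 _ m01) _ u01 v01).
  + move=> p /andP[p0 p1]; have [pm|mp] := leP p m.
      apply: mulr_le0; rewrite subr_le0; first exact: below.
      by apply: phi_mono => //; case/andP: m01.
    apply: mulr_ge0; rewrite subr_ge0; first exact/above/ltW.
    by apply: phi_mono => //; exact: ltW.
  + exact: X_fin.
  + exact: incX (ltW uv) v1.
- have v01 : 0 < v < 1 by rewrite (lt_trans u0 uv).
  have u01 : 0 < u < 1 by rewrite u0 (lt_trans uv).
  have [m [m0 mu below above]] := past_kernel_crossing _ _ _ eta_gt0 u0 uv.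
  have m01 : 0 < m < 1 by rewrite m0 (lt_trans mu)//; case/andP: u01.
  have phi_mono (p q : R) : 0 < p -> p <= q -> q < 1 -> phi q <= phi p.
    move=> p0 pq q1.
    have Qp0 : 0 < quantile X p by apply: QX_gt0; rewrite p0 (le_lt_trans pq).
    have Qpq : quantile X p <= quantile X q by exact: quantile_nondecreasing.
    have Qq0 := lt_le_trans Qp0 Qpq.
    have derive1N z : 0 < z -> derive1 (\- Psi) z = - derive1 Psi z.
      by move=> z0; rewrite !derive1E deriveN//; exact: Psi_derivable.
    rewrite -lerN2 -(derive1N _ Qp0) -(derive1N _ Qq0).
    apply: (convex_derive1_nondecreasing _ _ _ cPsi _ Qp0 Qpq) => z z0.
    exact/derivableN/Psi_derivable.
  apply: (le_DQFGCPE_reweight _ _ _ _ X Y phi (phi m) _ _ _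
    QX_derivable QY_derivable qYE phi_ge0 (phi_ge0 _ m01) _ v01 u01).
  + move=> p /andP[p0 p1]; have [pm|mp] := leP p m.
      apply: mulr_ge0; rewrite subr_ge0; first exact: below.
      by apply: phi_mono => //; case/andP: m01.
    apply: mulr_le0; rewrite subr_le0; first exact/above/ltW.
    by apply: phi_mono => //; exact: ltW.
  + exact: X_fin.
  + exact: decX (ltW uv) v1.
Qed.
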